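(* Let $\mathsf{C}$ be a Markov category with conditionals, and suppose that all invariant objects of $\mathsf{PS(C)}$ exist (for example, $\mathsf{C}=\mathsf{BorelStoch}$). Let $D:M\to\mathsf{PS(C)}$ be a dynamical system acting on the object $(X,p)$, with invariant object $r:(X,p)\to(X_{\mathrm{inv}},p_{\mathrm{inv}})$, and let $r^\dagger:(X_{\mathrm{inv}},p_{\mathrm{inv}})\to(X,p)$ be the Bayesian inverse of $r$. Then: \begin{itemize} \item The morphism $r^\dagger:(X_{\mathrm{inv}},p_{\mathrm{inv}})\to(X,p)$ is ($p_{\mathrm{inv}}$-)almost surely ergodic. \item Every left-invariant morphism $g:(Y,q)\to(X,p)$ can be a.s. ergodically decomposed as $g\simeq_q r^\dagger\circ\tilde g$ for a unique $\tilde g:(Y,q)\to(X_{\mathrm{inv}},p_{\mathrm{inv}})$ (up to $q$-a.s. equality). \item For every left-invariant morphism $g:(Y,q)\to(X,p)$, any a.s. ergodic decomposition $(h,k)$ of $g$ can be uniquely reduced to the decomposition $(\tilde g,r^\dagger)$: if $h:(Y,q)\to(A,b)$ and $k:(A,b)\to(X,p)$ with $g\simeq_q k\circ h$ and $k$ $b$-a.s. ergodic, then there is a unique (up to $b$-a.s. equality) $b$-a.s. deterministic $d:(A,b)\to(X_{\mathrm{inv}},p_{\mathrm{inv}})$ with $r^\dagger\circ d\simeq_b k$ and $d\circ h\simeq_q\tilde g$. \end{itemize}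
   Context: A Markov category is a symmetric monoidal category $(\mathsf{C},\otimes,I)$ with $I$ terminal, in which each object $X$ carries a commutative comonoid structure $\mathrm{copy}_X:X\to X\otimes X$, $\mathrm{del}_X:X\to I$, compatible with $\otimes$ (as usual for Markov categories). Coherence isomorphisms are suppressed. A state on $X$ is a morphism $p:I\to X$. Morphisms $f,g:X\to Y$ are $p$-a.s. equal, $f\simeq_p g$, if $(\mathrm{id}_X\otimes f)\,\mathrm{copy}_X\,p=(\mathrm{id}_X\otimes g)\,\mathrm{copy}_X\,p$. A morphism $f:X\to Y$ is $p$-a.s. deterministic if $(\mathrm{id}_X\otimes \mathrm{copy}_Y f)\,\mathrm{copy}_X\,p=(\mathrm{id}_X\otimes (f\otimes f)\mathrm{copy}_X)\,\mathrm{copy}_X\,p$. $\mathsf{C}$ has conditionals if for every $f:A\to X\otimes Y$ there is $f_{|X}:X\otimes A\to Y$ with $f=(\mathrm{id}_X\otimes f_{|X})(\mathrm{copy}_X\otimes\mathrm{id}_A)(f_X\otimes\mathrm{id}_A)\mathrm{copy}_A$, where $f_X=(\mathrm{id}_X\otimes\mathrm{del}_Y)f$. A Bayesian inverse of $f:X\to Y$ relative to $p$ is a morphism $f^\dagger:Y\to X$ with $(\mathrm{id}_X\otimes f)\,\mathrm{copy}_X\,p=(f^\dagger\otimes\mathrm{id}_Y)\,\mathrm{copy}_Y\,f\,p$; it is unique up to $(f\circ p)$-a.s. equality, and exists when $\mathsf{C}$ has conditionals. The category $\mathsf{PS(C)}$ has as objects pairs $(X,p)$ with $p$ a state on $X$;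 morphisms $(X,p)\to(Y,q)$ are morphisms $f:X\to Y$ of $\mathsf{C}$ with $f\circ p=q$, modulo $p$-a.s. equality (a Markov category with conditionals is causal, so composition is well defined). $\mathsf{BorelStoch}$ is the Markov category of standard Borel spaces and Markov kernels. A dynamical system $D:M\to\mathsf{PS(C)}$ acting on $(X,p)$ is a functor from the monoid $M$ (as a one-object category) sending the single object to $(X,p)$; the endomorphism induced by $m\in M$ is again denoted $m$. A morphism $f:(X,p)\to(Y,q)$ is right-invariant if $f\circ m\simeq_p f$ for all $m\in M$; a morphism $g:(Y,q)\to(X,p)$ is left-invariant if $m\circ g\simeq_q g$ for all $m\in M$. An invariant object for $D$ is an object $(X_{\mathrm{inv}},p_{\mathrm{inv}})$ with a morphism $r:(X,p)\to(X_{\mathrm{inv}},p_{\mathrm{inv}})$ of $\mathsf{PS(C)}$ such that: (i) it is a colimit of $D$ in $\mathsf{PS(C)}$, i.e. $r\circ m\simeq_p r$ for all $m$ and for every right-invariant $f:(X,p)\to(Y,q)$ there is a unique (up to $p_{\mathrm{inv}}$-a.s. equality) $\tilde f:(X_{\mathrm{inv}},p_{\mathrm{inv}})\to(Y,q)$ with $\tilde f\circ r\simeq_p f$; (ii) $f$ is $p$-a.s. deterministic if and only if $\tilde f$ is $p_{\mathrm{inv}}$-a.s. deterministic. A morphism $k:(A,b)\to(X,p)$ is $b$-almost surely ergodic if $r\circ k:A\to X_{\mathrm{inv}}$ is $b$-a.s. deterministic and $k$ is left-invariant. A decomposition of $f:(Y,q)\to(X,p)$ is a pair $(g,k)$ of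 morphisms $g:(Y,q)\to(A,b)$, $k:(A,b)\to(X,p)$ of $\mathsf{PS(C)}$ with $f\simeq_q k\circ g$; it is an almost sure ergodic decomposition if $k$ is $b$-a.s. ergodic. Given decompositions $(g,k)$ through $(A,b)$ and $(g',k')$ through $(A',b')$ of $f$, $(g',k')$ is a reduction of $(g,k)$ if there is a $b$-a.s. deterministic $d:(A,b)\to(A',b')$ with $k'\circ d\simeq_b k$ and $d\circ g\simeq_q g'$. *)

(* Defs.v *)
From mathcomp Require Import all_boot.

Set Implicit Arguments.
Unset Strict Implicit.
Unset Printing Implicit Defensive.

Declare Scope markov_scope.
Delimit Scope markov_scope with K.
Local Open Scope markov_scope.

Reserved Notation "X ~> Y" (at level 70, no associativity).
Reserved Notation "g ∘ f" (at level 40, left associativity).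
Reserved Notation "X ⊗ Y" (at level 30, right associativity).
Reserved Notation "f ⊠ g" (at level 30, right associativity).

Record category := Category {
  obj :> Type;
  hom : obj -> obj -> Type;
  idm : forall X, hom X X;
  comp : forall X Y Z, hom Y Z -> hom X Y -> hom X Z;
  comp1m : forall X Y (f : hom X Y), comp (idm Y) f = f;
  compm1 : forall X Y (f : hom X Y), comp f (idm X) = f;
  compA : forall W X Y Z (h : hom Y Z) (g : hom X Y) (f : hom W X),
    comp h (comp g f) = comp (comp h g) f }.

Arguments idm {_} X.

Notation "X ~> Y" := (hom X Y) : markov_scope.
Notation "g ∘ f" := (comp g f) : markov_scope.

(* A general, not necessarily strict, symmetric monoidal category. The
   remaining coherence conditions (the second hexagon, the compatibility of
   the symmetry with the unitors) are consequences of the listed ones. *)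
Record symMonCategory := SymMonCategory {
  smc_cat :> category;
  tens : smc_cat -> smc_cat -> smc_cat;
  tensm : forall X X' Y Y' : smc_cat,
    X ~> X' -> Y ~> Y' -> tens X Y ~> tens X' Y';
  munit : smc_cat;
  assoc : forall X Y Z, tens (tens X Y) Z ~> tens X (tens Y Z);
  assocV : forall X Y Z, tens X (tens Y Z) ~> tens (tens X Y) Z;
  lunit : forall X, tens munit X ~> X;
  lunitV : forall X, X ~> tens munit X;
  runit : forall X, tens X munit ~> X;
  runitV : forall X, X ~> tens X munit;
  swap : forall X Y, tens X Y ~> tens Y X;
  tensm1 : forall X Y, tensm (idm X) (idm Y) = idm (tens X Y);
  tensm_comp : forall X X' X'' Y Y' Y''
      (f' : X' ~> X'') (f : X ~> X') (g' : Y' ~> Y'') (g : Y ~> Y'),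
    tensm (f' ∘ f) (g' ∘ g) = tensm f' g' ∘ tensm f g;
  assocK : forall X Y Z, assocV X Y Z ∘ assoc X Y Z = idm _;
  assocVK : forall X Y Z, assoc X Y Z ∘ assocV X Y Z = idm _;
  lunitK : forall X, lunitV X ∘ lunit X = idm _;
  lunitVK : forall X, lunit X ∘ lunitV X = idm _;
  runitK : forall X, runitV X ∘ runit X = idm _;
  runitVK : forall X, runit X ∘ runitV X = idm _;
  swapK : forall X Y, swap Y X ∘ swap X Y = idm _;
  assoc_nat : forall X X' Y Y' Z Z' (f : X ~> X') (g : Y ~> Y') (h : Z ~> Z'),
    assoc X' Y' Z' ∘ tensm (tensm f g) h = tensm f (tensm g h) ∘ assoc X Y Z;
  lunit_nat : forall X Y (f : X ~> Y),
    lunit Y ∘ tensm (idm munit) f = f ∘ lunit X;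
  runit_nat : forall X Y (f : X ~> Y),
    runit Y ∘ tensm f (idm munit) = f ∘ runit X;
  swap_nat : forall X X' Y Y' (f : X ~> X') (g : Y ~> Y'),
    swap X' Y' ∘ tensm f g = tensm g f ∘ swap X Y;
  triangle : forall X Y,
    tensm (idm X) (lunit Y) ∘ assoc X munit Y = tensm (runit X) (idm Y);
  pentagon : forall W X Y Z,
    assoc W X (tens Y Z) ∘ assoc (tens W X) Y Z
    = tensm (idm W) (assoc X Y Z) ∘ assoc W (tens X Y) Z
      ∘ tensm (assoc W X Y) (idm Z);
  hexagon : forall X Y Z,
    assoc Y Z X ∘ swap X (tens Y Z) ∘ assoc X Y Z
    = tensm (idm Y) (swap X Z) ∘ assoc Y X Z ∘ tensm (swap X Y) (idm Z) }.

Arguments munit {_}.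
Notation "X ⊗ Y" := (tens X Y) : markov_scope.
Notation "f ⊠ g" := (tensm f g) : markov_scope.

Definition interchange (C : symMonCategory) (X Y : C) :
    (X ⊗ X) ⊗ (Y ⊗ Y) ~> (X ⊗ Y) ⊗ (X ⊗ Y) :=
  assocV X Y (X ⊗ Y)
  ∘ (idm X ⊠ (assoc Y X Y ∘ (swap X Y ⊠ idm Y) ∘ assocV X Y Y))
  ∘ assoc X X (Y ⊗ Y).

(* [del_terminal] says that the unit is terminal; it also forces [del] to be
   compatible with tensor products, and together with [copy_lunit] it forces
   the copy morphism of the unit to be the inverse unitor. *)
Record markovCategory := MarkovCategory {
  markov_smc :> symMonCategory;
  copy : forall X : markov_smc, X ~> X ⊗ X;
  del : forall X : markov_smc, X ~> munit;
  del_terminal : forall (X : markov_smc) (f : X ~> munit), f = del X;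
  copy_assoc : forall X : markov_smc,
    assoc X X X ∘ (copy X ⊠ idm X) ∘ copy X = (idm X ⊠ copy X) ∘ copy X;
  copy_lunit : forall X : markov_smc,
    lunit X ∘ (del X ⊠ idm X) ∘ copy X = idm X;
  copy_runit : forall X : markov_smc,
    runit X ∘ (idm X ⊠ del X) ∘ copy X = idm X;
  copy_swap : forall X : markov_smc, swap X X ∘ copy X = copy X;
  copy_tens : forall X Y : markov_smc,
    copy (X ⊗ Y) = interchange X Y ∘ (copy X ⊠ copy Y) }.

Notation state X := (munit ~> X).

Definition as_eq (C : markovCategory) (X Y : C) (p : state X) (f g : X ~> Y) :=
  (idm X ⊠ f) ∘ copy X ∘ p = (idm X ⊠ g) ∘ copy X ∘ p.

Definition as_deterministic (C : markovCategory) (X Y : C) (p : state X)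
    (f : X ~> Y) :=
  (idm X ⊠ (copy Y ∘ f)) ∘ copy X ∘ p
  = (idm X ⊠ ((f ⊠ f) ∘ copy X)) ∘ copy X ∘ p.

Definition marginal (C : markovCategory) (A X Y : C) (f : A ~> X ⊗ Y) :
    A ~> X :=
  runit X ∘ (idm X ⊠ del Y) ∘ f.

Definition has_conditionals (C : markovCategory) :=
  forall (A X Y : C) (f : A ~> X ⊗ Y), exists fX : X ⊗ A ~> Y,
    f = (idm X ⊠ fX) ∘ assoc X X A ∘ (copy X ⊠ idm A)
        ∘ (marginal f ⊠ idm A) ∘ copy A.

Definition bayesian_inverse (C : markovCategory) (X Y : C) (p : state X)
    (f : X ~> Y) (fd : Y ~> X) :=
  (idm X ⊠ f) ∘ copy X ∘ p = (fd ⊠ idm Y) ∘ copy Y ∘ f ∘ p.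

(* The category PS(C) is presented with its morphisms as a setoid: [ps_hom] is
   the type of representatives, and two of them denote the same morphism of
   PS(C) when they are related by [ps_eq], that is, when they are almost surely
   equal with respect to the state of the source. *)
Record psObject (C : markovCategory) := PsObject {
  ps_carrier :> C;
  ps_state : state ps_carrier }.

Record psHom (C : markovCategory) (X Y : psObject C) := PsHom {
  ps_mor :> ps_carrier X ~> ps_carrier Y;
  ps_morP : ps_mor ∘ ps_state X = ps_state Y }.

Definition ps_eq (C : markovCategory) (X Y : psObject C) (f g : psHom X Y) :=
  as_eq (ps_state X) f g.

Notation "f ≃ g" := (ps_eq f g) (at level 70, no associativity) : markov_scope.

Definition ps_id (C : markovCategory) (X : psObject C) : psHom X X :=
  PsHom (comp1m (ps_state X)).

Lemma ps_comp_subproof (C : markovCategory) (X Y Z : psObject C)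
    (g : psHom Y Z) (f : psHom X Y) : (g ∘ f) ∘ ps_state X = ps_state Z.
Proof. by rewrite -compA !ps_morP. Qed.

Definition ps_comp (C : markovCategory) (X Y Z : psObject C)
    (g : psHom Y Z) (f : psHom X Y) : psHom X Z :=
  PsHom (ps_comp_subproof g f).

Notation "g ⊚ f" := (ps_comp g f) (at level 40, left associativity)
  : markov_scope.

Definition ps_deterministic (C : markovCategory) (X Y : psObject C)
    (f : psHom X Y) :=
  as_deterministic (ps_state X) f.

Definition ps_exists_unique (C : markovCategory) (X Y : psObject C)
    (P : psHom X Y -> Prop) :=
  exists2 f, P f & forall f', P f' -> f' ≃ f.

(* A functor to PS(C) from the one-object category of the monoid [M] with
   multiplication [mul] and neutral element [e]. *)
Record dynamicalSystem (C : markovCategory) (M : Type) (e : M)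
    (mul : Monoid.law e) (X : psObject C) := DynamicalSystem {
  act :> M -> psHom X X;
  act1 : act e ≃ ps_id X;
  actM : forall m n, act (mul m n) ≃ act m ⊚ act n }.

Section Invariance.

Variables (C : markovCategory) (M : Type) (e : M) (mul : Monoid.law e).
Variables (X : psObject C) (D : dynamicalSystem mul X).

Definition right_invariant (Y : psObject C) (f : psHom X Y) :=
  forall m, f ⊚ D m ≃ f.

Definition left_invariant (Y : psObject C) (g : psHom Y X) :=
  forall m, D m ⊚ g ≃ g.

Record invariant_object (Xinv : psObject C) (r : psHom X Xinv) : Prop :=
  InvariantObject {
    inv_cocone : right_invariant r;
    inv_colimit : forall (Y : psObject C) (f : psHom X Y), right_invariant f ->
      ps_exists_unique (fun ft : psHom Xinv Y => ft ⊚ r ≃ f);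
    inv_deterministic : forall (Y : psObject C) (f : psHom X Y)
        (ft : psHom Xinv Y), right_invariant f -> ft ⊚ r ≃ f ->
      ps_deterministic f <-> ps_deterministic ft }.

Definition as_ergodic (Xinv : psObject C) (r : psHom X Xinv)
    (A : psObject C) (k : psHom A X) :=
  ps_deterministic (r ⊚ k) /\ left_invariant k.

End Invariance.

Definition has_invariant_objects (C : markovCategory) :=
  forall (M : Type) (e : M) (mul : Monoid.law e) (X : psObject C)
    (D : dynamicalSystem mul X),
  exists (Xinv : psObject C) (r : psHom X Xinv), invariant_object D r.

Definition decomposition (C : markovCategory) (Y X A : psObject C)
    (f : psHom Y X) (g : psHom Y A) (k : psHom A X) :=
  f ≃ k ⊚ g.

Definition as_ergodic_decomposition (C : markovCategory) (M : Type) (e : M)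
    (mul : Monoid.law e) (X : psObject C) (D : dynamicalSystem mul X)
    (Xinv : psObject C) (r : psHom X Xinv) (Y A : psObject C)
    (f : psHom Y X) (g : psHom Y A) (k : psHom A X) :=
  decomposition f g k /\ as_ergodic D r k.

(* [d] exhibits the decomposition (g', k') as a reduction of (g, k). *)
Definition reduction (C : markovCategory) (X Y A A' : psObject C)
    (g : psHom Y A) (k : psHom A X) (g' : psHom Y A') (k' : psHom A' X)
    (d : psHom A A') :=
  [/\ ps_deterministic d, k' ⊚ d ≃ k & d ⊚ g ≃ g'].

(* Main.v *)
From mathcomp Require Import all_boot.
Require Import Defs.

(** In PS(C), Bayesian inversion is a dagger: it is symmetric, contravariant and
    unique up to almost sure equality. Since [r] corresponds to the identity of
    [Xinv] under the universal property, it is a.s. deterministic, so its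
    Bayesian inverse [rd] satisfies [r ∘ rd ≃ id]. Conversely, when conditionals
    exist, any section of a morphism is its Bayesian inverse. As
    [r ∘ (m ∘ rd) ≃ r ∘ rd ≃ id], the section [m ∘ rd] is a.s. equal to [rd].

    For a left-invariant [g], it remains to see that its Bayesian inverse [gd]
    factors through [r], since then [g ≃ rd ∘ t] for some [t], and necessarily
    [t ≃ r ∘ g]. Now [gd] is invariant under the Bayesian inverses of the
    dynamics, hence factors through the invariant object [s] of the reversed
    dynamics. By the previous argument applied to [s], its Bayesian inverse is
    left-invariant under the reversed dynamics, so [s] is right-invariant under
    the original dynamics, and so is [gd]. *)

Set Implicit Arguments.
Unset Strict Implicit.
Unset Printing Implicit Defensive.

Local Open Scope markov_scope.

Section MarkovCategory.

Variable C : markovCategory.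
Implicit Types (X Y Z : C).

(** * Calculus of tensors, copies and marginals *)

Lemma tensm_compl X X' X'' Y Y' (f' : X' ~> X'') (f : X ~> X') (g : Y ~> Y') :
  (f' ∘ f) ⊠ g = (f' ⊠ idm Y') ∘ (f ⊠ g).
Proof. by rewrite -tensm_comp comp1m. Qed.

Lemma tensm_compr X X' Y Y' Y'' (f : X ~> X') (g' : Y' ~> Y'') (g : Y ~> Y') :
  f ⊠ (g' ∘ g) = (idm X' ⊠ g') ∘ (f ⊠ g).
Proof. by rewrite -tensm_comp comp1m. Qed.

Lemma tensm_exchange X X' Y Y' (f : X ~> X') (g : Y ~> Y') :
  (f ⊠ idm Y') ∘ (idm X ⊠ g) = (idm X' ⊠ g) ∘ (f ⊠ idm Y).
Proof. by rewrite -!tensm_comp !comp1m !compm1. Qed.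

Lemma swap_copyr X Y (f : X ~> Y) :
  swap X Y ∘ ((idm X ⊠ f) ∘ copy X) = (f ⊠ idm X) ∘ copy X.
Proof. by rewrite compA swap_nat -compA copy_swap. Qed.

Lemma swap_copyl X Y (f : X ~> Y) :
  swap Y X ∘ ((f ⊠ idm X) ∘ copy X) = (idm X ⊠ f) ∘ copy X.
Proof. by rewrite compA swap_nat -compA copy_swap. Qed.

Definition proj1 X Y : X ⊗ Y ~> X := runit X ∘ (idm X ⊠ del Y).
Definition proj2 X Y : X ⊗ Y ~> Y := lunit Y ∘ (del X ⊠ idm Y).

Lemma proj1_copy X : proj1 X X ∘ copy X = idm X.
Proof. exact: copy_runit. Qed.

Lemma proj2_copy X : proj2 X X ∘ copy X = idm X.
Proof. exact: copy_lunit. Qed.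

Lemma proj1_tensm X X' Y Y' (f : X ~> X') (g : Y ~> Y') :
  proj1 X' Y' ∘ (f ⊠ g) = f ∘ proj1 X Y.
Proof.
rewrite /proj1 -compA -tensm_comp comp1m (del_terminal (del Y' ∘ g)).
by rewrite compA -runit_nat -compA -tensm_comp compm1 comp1m.
Qed.

Lemma proj2_tensm X X' Y Y' (f : X ~> X') (g : Y ~> Y') :
  proj2 X' Y' ∘ (f ⊠ g) = g ∘ proj2 X Y.
Proof.
rewrite /proj2 -compA -tensm_comp comp1m (del_terminal (del X' ∘ f)).
by rewrite compA -lunit_nat -compA -tensm_comp compm1 comp1m.
Qed.

Lemma lunit_inj X Y (f g : X ~> Y) : idm munit ⊠ f = idm munit ⊠ g -> f = g.
Proof.
move=> fg; rewrite -[f]compm1 -[g]compm1 -(lunitVK X) !compA.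
by rewrite -!lunit_nat fg.
Qed.

(* Kelly's argument: tensored with [munit] and precomposed with an isomorphism,
   both sides are equal by the pentagon and the triangle. *)
Lemma lunit_tens X Y : lunit (X ⊗ Y) ∘ assoc munit X Y = lunit X ⊠ idm Y.
Proof.
apply: lunit_inj.
pose E := assoc munit (munit ⊗ X) Y ∘ (assoc munit munit X ⊠ idm Y).
pose E' := (assocV munit munit X ⊠ idm Y) ∘ assocV munit (munit ⊗ X) Y.
have EK : E ∘ E' = idm _.
  rewrite /E /E' !compA -[_ ∘ (_ ⊠ _) ∘ (_ ⊠ _)]compA -tensm_comp comp1m.
  by rewrite assocVK tensm1 compm1 assocVK.
suff eqE : (idm munit ⊠ (lunit (X ⊗ Y) ∘ assoc munit X Y)) ∘ E
    = (idm munit ⊠ (lunit X ⊠ idm Y)) ∘ E.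
  by rewrite -[LHS]compm1 -EK compA eqE -compA EK compm1.
rewrite /E tensm_compr -compA (compA (idm munit ⊠ assoc _ _ _)) -pentagon.
rewrite !compA triangle -(assoc_nat (idm munit)) -tensm1 -assoc_nat -triangle.
by rewrite -[RHS]compA -tensm_comp comp1m.
Qed.

(** This is the counit law of [copy], carried past the associator by [lunit_tens]. *)
Lemma proj2_assoc_copy X Y :
  proj2 X (X ⊗ Y) ∘ assoc X X Y ∘ (copy X ⊠ idm Y) = idm (X ⊗ Y).
Proof.
rewrite /proj2 -(compA (lunit _)) -tensm1 -assoc_nat compA lunit_tens.
by rewrite -!tensm_comp !comp1m copy_lunit.
Qed.

Lemma runit_inj X Y (f g : X ~> Y ⊗ munit) :
  runit Y ∘ f = runit Y ∘ g -> f = g.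
Proof.
by move=> fg; rewrite -[f]comp1m -[g]comp1m -runitK -!compA fg.
Qed.

(* The conditional of a state is a map out of [X ⊗ munit]; composing it with
   [(idm X ⊠ del X) ∘ copy X] turns it into a map out of [X]. *)
Lemma state_disintegration (condC : has_conditionals C) X Y
    (s : state (X ⊗ Y)) :
  exists c : X ~> Y, s = (idm X ⊠ c) ∘ copy X ∘ (proj1 X Y ∘ s).
Proof.
have [c sE] := condC _ _ _ s.
exists (c ∘ ((idm X ⊠ del X) ∘ copy X)); rewrite {1}sE -/(proj1 X Y).
set t := _ ∘ s.
(* As [munit] is terminal, the parameter wire may be replaced by a discarded copy of the sample. *)
have tE : (t ⊠ idm munit) ∘ copy munit = (idm X ⊠ del X) ∘ copy X ∘ t.
  apply: runit_inj; rewrite !compA runit_nat -/(proj1 X X) proj1_copy comp1m.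
  have <- : proj1 munit munit = runit munit.
    by rewrite /proj1 -(del_terminal (idm munit)) tensm1 compm1.
  by rewrite -compA proj1_copy compm1.
rewrite -[_ ∘ copy munit]compA tE 2!tensm_compr -!compA; congr (_ ∘ _).
rewrite !compA -(compA (idm X ⊠ (idm X ⊠ del X))) -copy_assoc !compA -assoc_nat.
by rewrite tensm1 -[assoc _ _ _ ∘ _ ∘ _ in LHS]compA tensm_exchange !compA.
Qed.

(** * Almost sure equality *)

Lemma as_eq_comp X Y Z (p : state X) (f f' : X ~> Y) (g : Y ~> Z) :
  as_eq p f f' -> as_eq p (g ∘ f) (g ∘ f').
Proof. by rewrite /as_eq !tensm_compr -!(compA (_ ⊠ g)) => ->. Qed.

Lemma as_eq_swap X Y (p : state X) (f f' : X ~> Y) :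
  as_eq p f f' <-> (f ⊠ idm X) ∘ copy X ∘ p = (f' ⊠ idm X) ∘ copy X ∘ p.
Proof.
rewrite /as_eq; split=> ff'.
  by rewrite -!swap_copyr -!(compA (swap _ _)) ff'.
by rewrite -!swap_copyl -!(compA (swap _ _)) ff'.
Qed.

(** By coassociativity, an extra copy of the input is obtained by post-processing
    [(idm X ⊠ h) ∘ copy X], in the same way for every [h]. *)
Lemma as_eq_pairing X Y (p : state X) (f f' : X ~> Y) :
  as_eq p f f' ->
  as_eq p ((f ⊠ idm X) ∘ copy X) ((f' ⊠ idm X) ∘ copy X).
Proof.
suff E (h : X ~> Y) : (idm X ⊠ ((h ⊠ idm X) ∘ copy X)) ∘ copy X
    = (idm X ⊠ swap X Y) ∘ assoc X X Y ∘ (copy X ⊠ idm Y)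
      ∘ ((idm X ⊠ h) ∘ copy X).
  by rewrite /as_eq !E -!(compA (_ ∘ _ ∘ _)) => ->.
rewrite -swap_copyr !tensm_compr -!compA; congr (_ ∘ _).
rewrite -copy_assoc !compA -assoc_nat tensm1.
by rewrite -[assoc _ _ _ ∘ _ ∘ _ in RHS]compA tensm_exchange !compA.
Qed.

Lemma proj2_as_eq X Y (p : state X) (f f' : X ~> Y) :
  as_eq p f f' -> f ∘ p = f' ∘ p.
Proof.
have E (h : X ~> Y) : proj2 X Y ∘ ((idm X ⊠ h) ∘ copy X ∘ p) = h ∘ p.
  by rewrite !compA proj2_tensm -(compA h) proj2_copy compm1.
by move=> ff'; rewrite -E ff' E.
Qed.

End MarkovCategory.

Section ProbabilitySpaces.

Variable C : markovCategory.
Hypothesis condC : has_conditionals C.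
Implicit Types (X Y Z : psObject C).

Notation inverse_of f fd := (bayesian_inverse (ps_state _) f fd).

(** * Composition and Bayesian inversion in PS(C) *)

Lemma ps_sym X Y (f g : psHom X Y) : f ≃ g -> g ≃ f.
Proof. exact: esym. Qed.

Lemma ps_trans X Y (f g h : psHom X Y) : f ≃ g -> g ≃ h -> f ≃ h.
Proof. exact: etrans. Qed.

Lemma ps_compA X Y Z T (h : psHom Z T) (g : psHom Y Z) (f : psHom X Y) :
  h ⊚ (g ⊚ f) ≃ h ⊚ g ⊚ f.
Proof. by rewrite /ps_eq /= compA. Qed.

Lemma ps_compm1 X Y (f : psHom X Y) : f ⊚ ps_id X ≃ f.
Proof. by rewrite /ps_eq /= compm1. Qed.

Lemma ps_comp1m X Y (f : psHom X Y) : ps_id Y ⊚ f ≃ f.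
Proof. by rewrite /ps_eq /= comp1m. Qed.

Lemma ps_compl X Y Z (g : psHom Y Z) (f f' : psHom X Y) :
  f ≃ f' -> g ⊚ f ≃ g ⊚ f'.
Proof. exact: as_eq_comp. Qed.

Lemma bayesian_inverseE X Y (f : psHom X Y) (fd : psHom Y X) :
  inverse_of f fd <->
  (idm X ⊠ f) ∘ copy X ∘ ps_state X = (fd ⊠ idm Y) ∘ copy Y ∘ ps_state Y.
Proof. by rewrite /bayesian_inverse -[_ ∘ f ∘ _]compA ps_morP. Qed.

(** The inverse disintegrates the joint state of [f] and the identity over its first marginal
    [ps_state Y]; the second marginal shows that it preserves states. *)
Lemma bayesian_inverse_exists X Y (f : psHom X Y) :
  exists fd : psHom Y X, inverse_of f fd.
Proof.
have [c cE] :=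
  state_disintegration condC ((f ⊠ idm X) ∘ copy (ps_carrier X) ∘ ps_state X).
have marg : proj1 _ _ ∘ ((f ⊠ idm X) ∘ copy X ∘ ps_state X) = ps_state Y.
  by rewrite !compA proj1_tensm -(compA f) proj1_copy compm1 ps_morP.
rewrite {}marg in cE.
have cp : c ∘ ps_state Y = ps_state X.
  have /(congr1 (comp (proj2 _ _))) := cE.
  by rewrite !compA !proj2_tensm comp1m -(compA c) !proj2_copy compm1 comp1m.
exists (PsHom cp); apply/bayesian_inverseE => /=.
by rewrite -swap_copyl -[in RHS]swap_copyr -!(compA (swap _ _)) cE.
Qed.

Lemma bayesian_inverse_sym X Y (f : psHom X Y) (fd : psHom Y X) :
  inverse_of f fd -> inverse_of fd f.
Proof.
move/bayesian_inverseE => ffd; apply/bayesian_inverseE.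
by rewrite -swap_copyl -[in RHS]swap_copyr -!(compA (swap _ _)) ffd.
Qed.

Lemma bayesian_inverse_unique X Y (f : psHom X Y) (fd fd' : psHom Y X) :
  inverse_of f fd -> inverse_of f fd' -> fd ≃ fd'.
Proof.
move=> /bayesian_inverseE ffd /bayesian_inverseE ffd'.
by apply/as_eq_swap; rewrite -ffd -ffd'.
Qed.

Lemma bayesian_inverse_eq X Y (f f' : psHom X Y) (fd : psHom Y X) :
  f ≃ f' -> inverse_of f fd -> inverse_of f' fd.
Proof. by rewrite /bayesian_inverse -!compA !ps_morP !compA => ->. Qed.

Lemma bayesian_inverse_comp X Y Z (f : psHom X Y) (fd : psHom Y X)
    (g : psHom Y Z) (gd : psHom Z Y) :
  inverse_of f fd -> inverse_of g gd -> inverse_of (g ⊚ f) (fd ⊚ gd).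
Proof.
move=> /bayesian_inverseE ffd /bayesian_inverseE ggd; apply/bayesian_inverseE.
rewrite /= tensm_compr tensm_compl -!(compA (_ ⊠ ps_mor g)) ffd.
by rewrite -!(compA (ps_mor fd ⊠ _)) -ggd !compA tensm_exchange.
Qed.

(* Causality: a state-preserving [f] can be replaced by its Bayesian inverse on
   the other leg of the copy, which leaves [h] next to a copy of [Y]. *)
Lemma ps_compr X Y Z (h h' : psHom Y Z) (f : psHom X Y) :
  h ≃ h' -> h ⊚ f ≃ h' ⊚ f.
Proof.
have [fd /bayesian_inverseE ffd] := bayesian_inverse_exists f.
have E (k : psHom Y Z) : (idm X ⊠ (k ∘ f)) ∘ copy X ∘ ps_state X
    = (fd ⊠ idm Z) ∘ ((idm Y ⊠ k) ∘ copy Y ∘ ps_state Y).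
  by rewrite tensm_compr -!(compA (_ ⊠ k)) ffd !compA tensm_exchange.
by rewrite /ps_eq /as_eq /= !E => ->.
Qed.

(** Moving [fd] to the other leg as [f] turns the joint state of [f ∘ fd] and the identity into
    [(f ⊠ f) ∘ copy X ∘ ps_state X], which determinism makes [copy Y ∘ ps_state Y]. *)
Lemma deterministic_section X Y (f : psHom X Y) (fd : psHom Y X) :
  ps_deterministic f -> inverse_of f fd -> f ⊚ fd ≃ ps_id Y.
Proof.
move=> /proj2_as_eq; rewrite -!compA ps_morP => fdet /bayesian_inverseE ffd.
apply/as_eq_swap; rewrite /= tensm_compl -!(compA (ps_mor f ⊠ _)) -ffd !compA.
by rewrite -tensm_comp compm1 comp1m -(compA (_ ⊠ _)) -fdet tensm1 comp1m.
Qed.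

(* Conditioning [(f, id) ∘ k] on its first output [y'] gives [c] with
   [k y = c (y', y)] in law; as [f ∘ k] is a.s. the identity, [y'] and [y] may be
   identified. *)
Lemma section_bayesian_inverse X Y (f : psHom X Y) (k : psHom Y X) :
  f ⊚ k ≃ ps_id Y -> inverse_of f k.
Proof.
move=> fk; pose j := (f ⊠ idm X) ∘ copy (ps_carrier X) ∘ k.
have [c jE] := condC j.
have margj : marginal j = f ∘ k.
  rewrite /marginal -/(proj1 _ _) !compA proj1_tensm.
  by rewrite -[f ∘ _ ∘ _]compA proj1_copy compm1.
rewrite {}margj in jE.
pose u := ((f ∘ k) ⊠ idm Y) ∘ copy (ps_carrier Y).
have kE : ps_mor k = c ∘ u.
  have <- : proj2 _ _ ∘ j = k.
    by rewrite !compA proj2_tensm comp1m proj2_copy comp1m.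
  rewrite jE !compA proj2_tensm -!(compA c) proj2_assoc_copy comp1m.
  by rewrite /u !compA.
have uY : u ∘ ps_state Y = copy Y ∘ ps_state Y.
  by move/as_eq_swap: fk; rewrite tensm1 comp1m.
(* Equality on the state, as in [uY], is too weak here: [k] is replaced next to a retained copy of
   [Y]. *)
have ck : as_eq (ps_state Y) k (c ∘ copy (ps_carrier Y)).
  have := as_eq_comp c (as_eq_pairing fk).
  by rewrite -/u tensm1 comp1m kE.
have jY : j ∘ ps_state Y = (idm Y ⊠ k) ∘ copy Y ∘ ps_state Y.
  rewrite ck tensm_compr -!(compA (_ ⊠ c)) -copy_assoc jE.
  by rewrite -[_ ∘ copy Y]compA -/u -compA uY !compA.
apply/bayesian_inverseE; rewrite -swap_copyl -[in RHS]swap_copyr.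
by rewrite -!(compA (swap _ _)) -jY /j -!compA ps_morP.
Qed.

(** * Invariance under a dynamics and its reversal *)

Lemma section_inverse_fixed X Z (r : psHom X Z) (rd : psHom Z X)
    (m : psHom X X) :
  ps_deterministic r -> inverse_of r rd -> r ⊚ m ≃ r -> m ⊚ rd ≃ rd.
Proof.
move=> rdet rrd rm; apply: (bayesian_inverse_unique (f := r)) (rrd).
apply: section_bayesian_inverse; apply: ps_trans (ps_compA _ _ _) _.
by apply: ps_trans (ps_compr _ rm) _; apply: deterministic_section.
Qed.

Lemma inverse_fixed X Y (g : psHom Y X) (gd : psHom X Y) (m n : psHom X X) :
  inverse_of g gd -> inverse_of m n -> m ⊚ g ≃ g -> gd ⊚ n ≃ gd.
Proof.
move=> ggd mn mg; apply: (bayesian_inverse_unique (f := g)) (ggd).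
by apply: bayesian_inverse_eq mg _; apply: bayesian_inverse_comp.
Qed.

Lemma invariant_deterministic (M : Type) (e : M) (mul : Monoid.law e) X
    (D : dynamicalSystem mul X) Xinv (r : psHom X Xinv) :
  invariant_object D r -> ps_deterministic r.
Proof.
case=> rinv _ rdet; apply/(rdet _ _ (ps_id _) rinv (ps_comp1m r)).
by rewrite /ps_deterministic /as_deterministic /= compm1 tensm1 comp1m.
Qed.

(* Indexing by words in a set of endomorphisms makes the action strict, so that
   no choice of Bayesian inverses is needed to reverse a dynamical system. *)
Definition word_act X (P : psHom X X -> Prop) (w : seq {n | P n}) :
    psHom X X :=
  foldr (fun n f => sval n ⊚ f) (ps_id X) w.

Lemma word_act_nil X (P : psHom X X -> Prop) :
  word_act (P := P) [::] ≃ ps_id X.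
Proof. by []. Qed.

Lemma word_act_cat X (P : psHom X X -> Prop) (v w : seq {n | P n}) :
  word_act (v ++ w) ≃ word_act v ⊚ word_act w.
Proof.
elim: v => [|n v IHv] /=; first exact/ps_sym/ps_comp1m.
exact: ps_trans (ps_compl _ IHv) (ps_compA _ _ _).
Qed.

Definition word_system X (P : psHom X X -> Prop) :
    dynamicalSystem (@cat {n | P n}) X :=
  DynamicalSystem (word_act_nil P) (@word_act_cat X P).

Lemma left_invariant_retract (invC : has_invariant_objects C)
    (M : Type) (e : M) (mul : Monoid.law e) X (D : dynamicalSystem mul X)
    Xinv (r : psHom X Xinv) (rd : psHom Xinv X) :
  invariant_object D r -> inverse_of r rd ->
  forall Y (g : psHom Y X), left_invariant D g -> rd ⊚ (r ⊚ g) ≃ g.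
Proof.
move=> invr rrd Y g ginv.
have [gd ggd] := bayesian_inverse_exists g.
pose P (n : psHom X X) := exists m, inverse_of (D m) n.
have [Z [s invs]] := invC _ _ _ _ (word_system P).
have [sd ssd] := bayesian_inverse_exists s.
have s_fixed n : P n -> s ⊚ n ≃ s.
  move=> Pn; have := inv_cocone invs [:: exist _ n Pn].
  by apply: ps_trans; apply/ps_compl/ps_sym/ps_compm1.
have gdinv : right_invariant (word_system P) gd.
  elim=> [|[n [m mn]] w IHw] /=; first exact: ps_compm1.
  apply: ps_trans (ps_compA _ _ _) _; apply: ps_trans IHw.
  exact/ps_compr/(inverse_fixed ggd mn).
have [t ts _] := inv_colimit invs gdinv.
have gdinvD : right_invariant D gd.
  move=> m; have [n mn] := bayesian_inverse_exists (D m).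
  have sn : s ⊚ n ≃ s by apply: s_fixed; exists m.
  (* First [n ⊚ sd ≃ sd], as [sd] inverts the deterministic [s]; inverting this equation brings back
     [s] and [D m]. *)
  have sm : s ⊚ D m ≃ s.
    apply: inverse_fixed (bayesian_inverse_sym ssd) (bayesian_inverse_sym mn) _.
    exact: section_inverse_fixed (invariant_deterministic invs) ssd sn.
  apply: ps_trans (ps_compr _ (ps_sym ts)) _; apply: (ps_trans _ ts).
  by apply: ps_trans (ps_sym (ps_compA _ _ _)) _; apply: ps_compl.
have [u ur _] := inv_colimit invr gdinvD.
have [ud uud] := bayesian_inverse_exists u.
have gE : rd ⊚ ud ≃ g.
  apply: bayesian_inverse_unique (bayesian_inverse_sym ggd).
  by apply: bayesian_inverse_eq ur _; apply: bayesian_inverse_comp.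
(* Composing [gE] with [r] and cancelling [r ⊚ rd] identifies [ud] with [r ⊚ g]. *)
apply: ps_trans (gE); apply: ps_compl.
apply: ps_trans (ps_compl _ (ps_sym gE)) _.
apply: ps_trans (ps_compA _ _ _) _; apply: ps_trans (ps_comp1m _).
exact/ps_compr/deterministic_section/rrd/(invariant_deterministic invr).
Qed.

End ProbabilitySpaces.

Theorem theorem3p29 (C : markovCategory) (condC : has_conditionals C)
    (invC : has_invariant_objects C)
    (M : Type) (e : M) (mul : Monoid.law e)
    (X : psObject C) (D : dynamicalSystem mul X)
    (Xinv : psObject C) (r : psHom X Xinv) (invr : invariant_object D r)
    (rd : psHom Xinv X) (bayes_rd : bayesian_inverse (ps_state X) r rd) :
  as_ergodic D r rd
  /\ (forall (Y : psObject C) (g : psHom Y X), left_invariant D g ->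
        ps_exists_unique
          (fun gt : psHom Y Xinv => as_ergodic_decomposition D r g gt rd))
  /\ (forall (Y : psObject C) (g : psHom Y X) (gt : psHom Y Xinv),
        left_invariant D g -> decomposition g gt rd ->
        forall (A : psObject C) (h : psHom Y A) (k : psHom A X),
          as_ergodic_decomposition D r g h k ->
          ps_exists_unique
            (fun d : psHom A Xinv => reduction h k gt rd d)).
Proof.
have rdet := invariant_deterministic invr.
have rrd := deterministic_section rdet bayes_rd.
have retract := left_invariant_retract condC invC invr bayes_rd.
(* Both uniqueness claims rest on cancelling [rd] by its retraction [r]. *)
have solve Y (f : psHom Y Xinv) (g : psHom Y X) : rd ⊚ f ≃ g -> f ≃ r ⊚ g.
  move=> fg; apply: ps_trans (ps_compl _ fg).
  apply: ps_trans (ps_sym (ps_compA _ _ _)).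
  apply: ps_trans (ps_sym (ps_comp1m f)) _.
  exact/(ps_compr condC)/ps_sym.
have rd_ergodic : as_ergodic D r rd.
  split; last first.
    by move=> m; apply: section_inverse_fixed (inv_cocone invr m).
  (* Thus [r ⊚ rd] is the map induced by the right-invariant [r], and inherits its determinism. *)
  have rE : r ⊚ rd ⊚ r ≃ r.
    by apply: ps_trans (ps_compr condC r rrd) _; apply: ps_comp1m.
  exact/(inv_deterministic invr (inv_cocone invr) rE).
split=> //; split=> [Y g ginv | Y g gt ginv ggt A h k [ghk [rk_det kinv]]].
  exists (r ⊚ g); first by split=> //; apply/ps_sym/retract.
  by move=> f [gf _]; apply/solve/ps_sym.
(* Determinism of this witness is part of the ergodicity of [k]. *)
exists (r ⊚ k); last by move=> d [_ rdd _]; apply: solve.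
split=> //; first exact: retract.
apply: ps_trans (ps_sym (ps_compA _ _ _)) _.
apply: ps_trans (ps_compl _ (ps_sym ghk)) _.
exact/ps_sym/solve/ps_sym.
Qed.
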